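(* Let $\alpha>0$ and $0<p<\infty$. Then the global quaternionic Fock space $F_\alpha^p$ and the slice quaternionic Fock space $\mathfrak F_\alpha^p$ coincide as sets and have equivalent norms. Moreover, the spaces $F_\alpha^2$ and $\mathfrak F_\alpha^2$ are isometrically isomorphic.
   Context: $\mathbb H$ denotes the quaternions, $\mathbb S=\{I\in\mathbb H: I^2=-1\}$, $\mathbb C_I=\{x+yI:x,y\in\mathbb R\}$ for $I\in\mathbb S$, and $m_{2,I}$ is Lebesgue measure on $\mathbb C_I$. A (left) slice function is $f:\mathbb H\to\mathbb H$ of the form $f(x+yI)=f_0(x,y)+If_1(x,y)$ for all $x,y\in\mathbb R$, $I\in\mathbb S$, where $f_0,f_1:\mathbb R^2\to\mathbb H$ satisfy $f_0(x,-y)=f_0(x,y)$ and $f_1(x,-y)=-f_1(x,y)$. It is slice regular if moreover $f_0,f_1$ are $C^1$ and $\partial_xf_0-\partial_yf_1=0$, $\partial_yf_0+\partial_xf_1=0$. Slice norm: for $I\in\mathbb S$, $\|f\|_{p,\alpha,I}^p=\frac{p\alpha}{2\pi}\int_{\mathbb C_I}|f(z)e^{-\alpha|z|^2/2}|^p\,dm_{2,I}(z)$. For a fixed $I\in\mathbb S$, $\mathfrak F_\alpha^p$ is the space of slice regular $f$ on $\mathbb H$ with $\|f\|_{p,\alpha,I}<\infty$, normed by $\|\cdot\|_{p,\alpha,I}$; the resulting space is independent of $I$ up to equivalence of norms. Global norm: every non-real quaternion is uniquely $x+yI$ with $I\in\mathbb S$, $y>0$, so $\mathbb H\setminus\mathbb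 R\cong\mathbb S\times\mathbb C^+$ (with $\mathbb C^+$ the open upper half plane), and $dV(x+yI)=dm_{2,I}(x+yI)\,d\sigma(I)$, where $\sigma$ is the normalized surface measure on $\mathbb S$; the real axis has $dV$-measure $0$. Put $\|f\|_{p,\alpha}^p=\frac{p\alpha}{\pi}\int_{\mathbb H}|f(z)e^{-\alpha|z|^2/2}|^p\,dV(z)$. $F_\alpha^p$ is the space of slice regular $f$ on $\mathbb H$ with $\|f\|_{p,\alpha}<\infty$, normed by $\|\cdot\|_{p,\alpha}$. (For $p<1$ these are quasi-norms.) *)

(* Defs.v *)
From HB Require Import structures.
From mathcomp Require Import all_boot all_order all_algebra.
From mathcomp Require Import all_classical all_reals all_analysis.
From mathcomp Require Import measurable_realfun ring.

Set Implicit Arguments.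
Unset Strict Implicit.
Unset Printing Implicit Defensive.

Import Order.TTheory GRing.Theory Num.Theory.
Import numFieldNormedType.Exports.

Local Open Scope classical_set_scope.
Local Open Scope ring_scope.

(* The quaternion a + b i + c j + d k is the tuple (a, b, c, d).  The real
   vector space structure, the topology and the (Borel) sigma-algebra are those
   of the product type.  Pitfalls: the library's ring product on tuples is
   componentwise and its norm is the sup norm, so neither is used here: see
   [qmul] and [qabs]. *)
Notation quat R := (R * R * R * R)%type.

Section Quaternions.
Context {R : realType}.
Implicit Types (q r I : quat R) (z : R * R).

Definition qre q : R := q.1.1.1.
Definition qi q : R := q.1.1.2.
Definition qj q : R := q.1.2.
Definition qk q : R := q.2.

Definition qreal (x : R) : quat R := (x, 0, 0, 0).

Definition qmul q r : quat R :=
  (qre q * qre r - qi q * qi r - qj q * qj r - qk q * qk r,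
   qre q * qi r + qi q * qre r + qj q * qk r - qk q * qj r,
   qre q * qj r - qi q * qk r + qj q * qre r + qk q * qi r,
   qre q * qk r + qi q * qj r - qj q * qi r + qk q * qre r).

Definition qabs q : R :=
  Num.sqrt (qre q ^+ 2 + qi q ^+ 2 + qj q ^+ 2 + qk q ^+ 2).

Definition imag_sphere : set (quat R) := [set I | qmul I I = qreal (- 1)].

(* x + y I, for z = (x, y) *)
Definition slice_point I z : quat R := qreal z.1 + z.2 *: I.

Definition slice_plane I : set (quat R) := range (slice_point I).

End Quaternions.

Section SliceRegular.
Context {R : realType}.
Implicit Types (g : R * R -> quat R) (f : quat R -> quat R).

Definition partial_x g : R * R -> quat R := fun z => 'D_(1, 0) g z.
Definition partial_y g : R * R -> quat R := fun z => 'D_(0, 1) g z.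

Definition C1 g : Prop :=
  [/\ forall z, derivable g z (1, 0), forall z, derivable g z (0, 1),
      continuous (partial_x g) & continuous (partial_y g)].

Definition slice_components f (f0 f1 : R * R -> quat R) : Prop :=
  [/\ forall x y, f0 (x, - y) = f0 (x, y),
      forall x y, f1 (x, - y) = - f1 (x, y) &
      forall I z, imag_sphere I ->
        f (slice_point I z) = f0 z + qmul I (f1 z)].

Definition slice_regular f : Prop :=
  exists f0 f1 : R * R -> quat R, [/\ slice_components f f0 f1, C1 f0, C1 f1 &
    forall z, partial_x f0 z - partial_y f1 z = 0 /\
              partial_y f0 z + partial_x f1 z = 0].

End SliceRegular.

Section Measures.
Context {R : realType}.
Local Open Scope ereal_scope.

Definition lebesgue2 : set (measurableTypeR R * measurableTypeR R) -> \bar R :=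
  lebesgue_measure \x lebesgue_measure.

(* m_{2,I}, as a measure on the quaternions carried by C_I: for I in the
   sphere, (x, y) |-> x + y I is an isometry from R^2 onto C_I. *)
Definition plane_measure (I : quat R) : set (quat R) -> \bar R :=
  pushforward lebesgue2 (slice_point I).

(* Spherical coordinates w = (theta, phi), theta being the polar angle; the
   surface element is sin theta dtheta dphi and the total area is 4 pi. *)
Definition sphere_param (w : R * R) : quat R :=
  (0, sin w.1 * cos w.2, sin w.1 * sin w.2, cos w.1)%R.

(* sigma, as a measure on the quaternions carried by the sphere. *)
Definition sphere_measure (A : set (quat R)) : \bar R :=
  \int[lebesgue2]_(w in (`[0%R, pi] `*` `[0%R, (2 * pi)%R])
                        `&` sphere_param @^-1` A)
    (sin w.1 / (4 * pi))%:E.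

(* dV(x + y I) = dm_{2,I}(x + y I) dsigma(I) with I in the sphere and y > 0:
   the image of the product measure under (I, (x, y)) |-> x + y I. *)
Definition quat_measure (A : set (quat R)) : \bar R :=
  (sphere_measure \x lebesgue2)
    ((imag_sphere `*` [set z : R * R | (0 < z.2)%R])
     `&` (fun w : quat R * (R * R) => slice_point w.1 w.2) @^-1` A).

End Measures.

Section MeasureFacts.
Context {R : realType}.
Local Open Scope ereal_scope.

HB.instance Definition _ := Measure.on (@lebesgue2 R).

Let lebesgue2_sigma_finite : sigma_finite setT (@lebesgue2 R).
Proof.
have /sigma_finiteP[F [TF ndF Foo]] := sigma_finiteT (@lebesgue_measure R).
exists (fun n => F n `*` F n).
  rewrite -setXTT {1 2}TF predeqE => -[x y]; split.
    move=> [/= [n _ Fnx] [k _ Fky]]; exists (maxn n k) => //; split.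
    - by move: x Fnx; exact/subsetPset/ndF/leq_maxl.
    - by move: y Fky; exact/subsetPset/ndF/leq_maxr.
  by move=> [n _ []/= ? ?]; split; exists n.
move=> k; have [? ?] := Foo k; split; first exact: measurableX.
by rewrite /lebesgue2 product_measure1E// lte_mul_pinfty// ge0_fin_numE.
Qed.

HB.instance Definition _ := Measure_isSigmaFinite.Build _ _ _ (@lebesgue2 R)
  lebesgue2_sigma_finite.

Let box : set (R * R) := `[0%R, pi] `*` `[0%R, (2 * pi)%R].

Let measurable_box : measurable box.
Proof. exact: measurableX. Qed.

Let sphere_density_ge0 (w : R * R) : box w -> 0 <= (sin w.1 / (4 * pi))%:E.
Proof.
move=> -[/= w1 _]; rewrite lee_fin divr_ge0//; last first.
  by rewrite mulr_ge0// pi_ge0.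
by apply: sin_ge0_pi; move: w1; rewrite in_itv.
Qed.

Let measurable_sphere_density :
  measurable_fun setT (fun w : R * R => sin w.1 / (4 * pi))%R.
Proof.
apply: measurable_funM => //.
apply: (measurableT_comp (f := sin)); last exact: measurable_fst.
by apply: continuous_measurable_fun; exact: continuous_sin.
Qed.

Lemma measurable_sphere_param : measurable_fun setT (@sphere_param R).
Proof.
have m1 (h : R -> R) : measurable_fun setT h ->
    measurable_fun setT (fun w : R * R => h w.1).
  by move=> mh; exact: (measurableT_comp mh measurable_fst).
have m2 (h : R -> R) : measurable_fun setT h ->
    measurable_fun setT (fun w : R * R => h w.2).
  by move=> mh; exact: (measurableT_comp mh measurable_snd).
have msin : measurable_fun setT (@sin R).
  by apply: continuous_measurable_fun; exact: continuous_sin.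
have mcos : measurable_fun setT (@cos R).
  by apply: continuous_measurable_fun; exact: continuous_cos.
by repeat apply: measurable_fun_pair => //=;
  try apply: measurable_funM; (exact: m1 || exact: m2).
Qed.

Let measurable_preimage (A : set (quat R)) : measurable A ->
  measurable (sphere_param @^-1` A).
Proof. by move=> mA; rewrite -[X in measurable X]setTI; exact: measurable_sphere_param. Qed.

Let sphere_measure0 : sphere_measure (R := R) set0 = 0.
Proof. by rewrite /sphere_measure preimage_set0 setI0 integral_set0. Qed.

Let sphere_measure_ge0 (A : set (quat R)) : 0 <= sphere_measure A.
Proof. by apply: integral_ge0 => w [/sphere_density_ge0]. Qed.

Let sphere_measure_sigma_additive :
  semi_sigma_additive (sphere_measure (R := R)).
Proof.
move=> /= F mF tF mUF; rewrite /sphere_measure; apply: cvg_toP.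
  apply: ereal_nondecreasing_is_cvgn => m n mn.
  by apply: lee_sum_nneg_natr => // k _ _; exact: sphere_measure_ge0.
rewrite preimage_bigcup setI_bigcupr ge0_integral_bigcup//=.
- by move=> k; apply: measurableI => //; exact: measurable_preimage.
- by apply: measurable_funTS; exact/measurable_EFinP.
- by move=> w [k _ [/sphere_density_ge0]].
- apply/trivIsetP => i j _ _ ij; rewrite setIACA setIid -preimage_setI.
  by move/trivIsetP : tF => ->//; rewrite preimage_set0 setI0.
Qed.

HB.instance Definition _ := isMeasure.Build _ _ _ (@sphere_measure R)
  sphere_measure0 sphere_measure_ge0 sphere_measure_sigma_additive.

Let integral_sin :
  \int[@lebesgue_measure R]_(x in `[0%R, pi]) (sin x / (4 * pi))%:E =
  (2 / (4 * pi))%:E.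
Proof.
have pi0 := @pi_gt0 R.
have cc : continuous (fun x : R => - cos x / (4 * pi))%R.
  move=> x; apply: cvgM; last exact: cvg_cst.
  by apply: cvgN; exact: continuous_cos.
rewrite (@continuous_FTC2 R (fun x => sin x / (4 * pi))%R
                            (fun x => - cos x / (4 * pi))%R)//.
- by rewrite cospi cos0 -EFinB -mulrBl opprK.
- apply: continuous_subspaceT => x.
  by apply: cvgM; [exact: continuous_sin | exact: cvg_cst].
- split.
  + by move=> x _; apply: derivableM.
  + by apply: cvg_at_right_filter; exact: cc.
  + by apply: cvg_at_left_filter; exact: cc.
- move=> x _; rewrite derive1E deriveM// derive_cst scaler0 add0r deriveN//.
  by rewrite derive_val opprK /GRing.scale/= mulrC.
Qed.

Let sphere_measureT : sphere_measure [set: quat R] = 1.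
Proof.
have pi0 := @pi_gt0 R.
rewrite /sphere_measure preimage_setT setIT -/box /lebesgue2 integral_mkcond.
rewrite fubini_tonelli1//=; last first.
- by move=> w; rewrite erestrict_ge0// => x /sphere_density_ge0.
- apply/(measurable_restrictT _ _).1 => //.
  by apply: measurable_funTS; exact/measurable_EFinP.
rewrite /fubini_F.
rewrite [X in integral _ _ X](_ : _ =
    (fun x => (sin x / (4 * pi))%:E * (2 * pi)%:E) \_ `[0%R, pi]); last first.
  apply/funext => x; rewrite [RHS]patchE; case: ifPn => hx.
    transitivity (\int[@lebesgue_measure R]_(y in `[0%R, (2 * pi)%R])
                     (sin x / (4 * pi))%:E).
      rewrite [RHS]integral_mkcond; apply: eq_integral => y _; rewrite !patchE.
      congr (if _ then _ else _); rewrite inE in hx.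
      by apply/idP/idP; rewrite !inE /box /=; [case|].
    rewrite integral_cst//= lebesgue_measure_itv/= lte_fin mulr_gt0//.
    by rewrite -EFinB subr0.
  apply: integral0_eq => y _; rewrite patchE; case: ifPn => //.
  by rewrite inE /= => -[h _]; move: hx; rewrite notin_setE.
rewrite -integral_mkcond/= ge0_integralZr//=.
- rewrite integral_sin -EFinM; congr EFin.
  by move: (@pi R) pi0 => t t0; field; exact: lt0r_neq0.
- apply: measurable_funTS; apply/measurable_EFinP.
  apply: measurable_funM => //.
  by apply: continuous_measurable_fun; exact: continuous_sin.
- move=> x; rewrite inE/= => x0pi.
  by apply: (@sphere_density_ge0 (x, 0%R)); split; rewrite //= in_itv/= lexx mulr_ge0// ltW.
- by rewrite lee_fin mulr_ge0// ltW.
Qed.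

HB.instance Definition _ :=
  Measure_isProbability.Build _ _ _ (@sphere_measure R) sphere_measureT.

End MeasureFacts.

Section FockSpaces.
Context {R : realType}.
Implicit Types (p alpha : R) (I : quat R) (f : quat R -> quat R).
Local Open Scope ereal_scope.

Definition fock_integrand p alpha f (z : quat R) : \bar R :=
  (((qabs (f z) * expR (- alpha * qabs z ^+ 2 / 2)) `^ p)%R)%:E.

Definition slice_norm p alpha I f : \bar R :=
  ((p * alpha / (2 * pi))%:E *
   \int[plane_measure I]_(z in slice_plane I) fock_integrand p alpha f z)
  `^ p^-1.

Definition global_norm p alpha f : \bar R :=
  ((p * alpha / pi)%:E *
   \int[quat_measure]_(z in setT) fock_integrand p alpha f z)
  `^ p^-1.

Definition slice_fock p alpha I : set (quat R -> quat R) :=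
  [set f | slice_regular f /\ slice_norm p alpha I f < +oo].

Definition global_fock p alpha : set (quat R -> quat R) :=
  [set f | slice_regular f /\ global_norm p alpha f < +oo].

Definition equivalent_norms (F : set (quat R -> quat R))
    (N1 N2 : (quat R -> quat R) -> \bar R) : Prop :=
  exists c C : R, [/\ (0 < c)%R, (0 < C)%R &
    forall f, F f -> c%:E * N1 f <= N2 f /\ N2 f <= C%:E * N1 f].

(* Spaces of left slice functions are right vector spaces over the
   quaternions; isomorphisms are the right-linear bijections. *)
Definition isometrically_isomorphic (F1 F2 : set (quat R -> quat R))
    (N1 N2 : (quat R -> quat R) -> \bar R) : Prop :=
  exists T : (quat R -> quat R) -> (quat R -> quat R),
    [/\ set_bij F1 F2 T,
        forall f g, F1 f -> F1 g ->
          T (fun q => (f q + g q)%R) = (fun q => (T f q + T g q)%R),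
        forall f (a : quat R), F1 f ->
          T (fun q => qmul (f q) a) = (fun q => qmul (T f q) a) &
        forall f, F1 f -> N2 (T f) = N1 f].

End FockSpaces.

(* Main.v *)
Require Import Defs.
From mathcomp Require Import all_boot all_order all_algebra.
From mathcomp Require Import all_classical all_reals all_analysis.
From mathcomp Require Import measurable_realfun ring lra.

(* Write [f(x + yJ) = f0 + J f1] with [f0], [f1] evaluated at [z = (x, y)].  By
   the parallelogram law, [|f(x + yJ)|^2 + |f(x - yJ)|^2 = 2 (|f0|^2 + |f1|^2)]
   does not depend on [J], so that [A_J := |f(x + yJ)|^p + |f(x - yJ)|^p]
   satisfies [A_J <= 2^(p+1) A_J'] for all [J], [J'] in the sphere, and
   [A_J = A_J'] if [p = 2].  The slice integral is the integral over the upper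
   half-plane of [A_I], while by antipodal symmetry of the sphere twice the
   global integral is the integral over the upper half-plane of the spherical
   mean of [A_J]; hence the two norms are equivalent, and equal if [p = 2]. *)

Set Implicit Arguments.
Unset Strict Implicit.
Unset Printing Implicit Defensive.

Import Order.TTheory GRing.Theory Num.Theory.
Import numFieldNormedType.Exports.

Local Open Scope classical_set_scope.
Local Open Scope ring_scope.

(** * Quaternions *)

Section Quaternions.
Context {R : realType}.
Implicit Types (q r I J : quat R).

Lemma sqr_qabs q :
  qabs q ^+ 2 = qre q ^+ 2 + qi q ^+ 2 + qj q ^+ 2 + qk q ^+ 2.
Proof. by rewrite sqr_sqrtr// !addr_ge0// sqr_ge0. Qed.

Lemma qabs_ge0 q : 0 <= qabs q. Proof. exact: sqrtr_ge0. Qed.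

Lemma qabs_eq0 q : qabs q = 0 -> q = 0.
Proof.
move=> q0; have := sqr_qabs q; rewrite q0 expr0n/=.
case: q {q0} => [[[a b] c] d]; rewrite /qre/qi/qj/qk/= => e.
have := sqr_ge0 a; have := sqr_ge0 b; have := sqr_ge0 c; have := sqr_ge0 d.
by move=> *; congr (_, _, _, _); apply/eqP; rewrite -sqrf_eq0; apply/eqP; lra.
Qed.

(** With [n] the squared length of the vector part of [I] and [a] its real part, the equation gives
    [a ^+ 2 - n = - 1] and forces [a] times each imaginary coordinate to vanish. Hence [a * n = 0],
    and [n = 0] would make [a ^+ 2] negative. *)
Lemma imag_sphereP I : imag_sphere I <->
  qre I = 0 /\ qi I ^+ 2 + qj I ^+ 2 + qk I ^+ 2 = 1.
Proof.
case: I => [[[a b] c] d]; rewrite /imag_sphere /qmul /qreal/= /qre/qi/qj/qk/=.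
split=> [[h0 h1 h2 h3]|[-> h]]; last first.
  by congr (_, _, _, _); move: h; rewrite ?expr2; lra.
(* Combine the three imaginary equations with weights [b], [c], [d]. *)
have : a * (b ^+ 2 + c ^+ 2 + d ^+ 2) = 0.
  have -> : a * (b ^+ 2 + c ^+ 2 + d ^+ 2) =
    ((a * b + b * a + c * d - d * c) * b + (a * c - b * d + c * a + d * b) * c
     + (a * d + b * c - c * b + d * a) * d) / 2 by field.
  by rewrite h1 h2 h3 !mul0r !addr0 mul0r.
move/eqP; rewrite mulf_eq0 => /orP[/eqP a0|/eqP n0].
  by split=> //; move: h0; rewrite a0 ?expr2; lra.
by have := sqr_ge0 a; move: h0 n0; rewrite !expr2; lra.
Qed.

Lemma imag_sphereN I : imag_sphere I -> imag_sphere (- I).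
Proof.
by move=> /imag_sphereP[h0 h1]; apply/imag_sphereP; move: h0 h1;
  rewrite /qre/qi/qj/qk/= => -> h1; rewrite oppr0 !sqrrN.
Qed.

(** The cross terms have opposite signs and cancel, and left multiplication by the unit [I]
    preserves the modulus of [r]. *)
Lemma qabs_parallelogram I q r : imag_sphere I ->
  qabs (q + qmul I r) ^+ 2 + qabs (q + qmul (- I) r) ^+ 2 =
  2 * (qabs q ^+ 2 + qabs r ^+ 2).
Proof.
move=> /imag_sphereP[]; rewrite !sqr_qabs.
case: I q r => [[[a b] c] d] [[[q0 q1] q2] q3] [[[r0 r1] r2] r3].
rewrite /qmul /qre/qi/qj/qk/= => -> h.
set s := r0 ^+ 2 + r1 ^+ 2 + r2 ^+ 2 + r3 ^+ 2.
transitivity (2 * (q0 ^+ 2 + q1 ^+ 2 + q2 ^+ 2 + q3 ^+ 2 +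
  (b ^+ 2 + c ^+ 2 + d ^+ 2) * s)); last by rewrite h mul1r.
by rewrite /s; ring.
Qed.

Lemma slice_pointE (a b c d x y : R) :
  slice_point (a, b, c, d) (x, y) = (x + y * a, y * b, y * c, y * d).
Proof. by congr (_, _, _, _); exact: add0r. Qed.

Lemma qabs_slice_point I (z : R * R) : imag_sphere I ->
  qabs (slice_point I z) ^+ 2 = z.1 ^+ 2 + z.2 ^+ 2.
Proof.
move=> /imag_sphereP[]; rewrite sqr_qabs.
case: I z => [[[a b] c] d] [x y].
rewrite /slice_point /qreal /qre/qi/qj/qk/= => -> h.
rewrite /GRing.scale/= -[X in _ = _ + X]mulr1 -h; ring.
Qed.

End Quaternions.

(** Each of [v], [v'] is at most the square root of [u ^+ 2 + u' ^+ 2], hence at most twice the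
    maximum of [u] and [u'], whose [p]-th power is at most the sum of the two [p]-th powers. Adding
    the two bounds turns [2 ^ p] into [2 ^ (p + 1)]. No convexity enters, so [p < 1] is covered. *)
Lemma powR_sum_bound {R : realType} (p v v' u u' : R) : 0 < p ->
  0 <= v -> 0 <= v' -> 0 <= u -> 0 <= u' ->
  v ^+ 2 + v' ^+ 2 = u ^+ 2 + u' ^+ 2 ->
  v `^ p + v' `^ p <= 2 `^ (p + 1) * (u `^ p + u' `^ p).
Proof.
move=> p0 v0 v'0 u0 u'0 e.
have key w : 0 <= w -> w ^+ 2 <= u ^+ 2 + u' ^+ 2 ->
    w `^ p <= 2 `^ p * (u `^ p + u' `^ p).
  move=> w0 hw.
  have wle : w <= 2 * Num.max u u'.
    rewrite leNgt; apply/negP => lt.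
    have m1 : u <= Num.max u u' by rewrite le_max lexx.
    have m2 : u' <= Num.max u u' by rewrite le_max lexx orbT.
    move: lt m1 m2; set m := Num.max _ _ => lt m1 m2; nra.
  have -> // : 2 `^ p * (u `^ p + u' `^ p) = (2 * u) `^ p + (2 * u') `^ p.
    by rewrite mulrDr !powRM.
  apply: (le_trans (ge0_ler_powR (ltW p0) _ _ wle)); rewrite ?nnegrE//.
    by rewrite mulr_ge0// le_max u0.
  by rewrite maxEle; case: ifP => _; rewrite ?lerDl ?lerDr powR_ge0.
have h1 := key v v0; have h2 := key v' v'0.
rewrite powRD ?powRr1//; last by apply/implyP.
have := sqr_ge0 v; have := sqr_ge0 v' => s1 s2.
have := h1 _; have := h2 _.
move=> /(_ ltac:(lra)) k1 /(_ ltac:(lra)) k2; lra.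
Qed.

(** * Measurability of partially differentiable functions *)

(* [h] is the pointwise limit of the functions obtained by rounding the first
   variable down to a multiple of [1 / n.+1]. *)
Lemma separately_continuous_measurable {R : realType} (h : R * R -> R) :
  (forall y, continuous (fun x => h (x, y))) ->
  (forall x, continuous (fun y => h (x, y))) ->
  measurable_fun setT h.
Proof.
move=> ch1 ch2.
pose grid (n : nat) (x : R) : R := (Num.floor (x * n.+1%:R))%:~R / n.+1%:R.
apply: (@measurable_fun_cvg _ _ _ _ (fun n w => h (grid n w.1, w.2))).
  move=> n _ A mA; rewrite setTI.
  pose F (k : int) : set (R * R) :=
    [set x | k%:~R <= x * n.+1%:R < (k + 1)%:~R] `*`
    ((fun y => h (k%:~R / n.+1%:R, y)) @^-1` A).
  (* On the strip indexed by [k] the rounded variable is constant, so only continuity in the second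
     variable matters there; the strips are countably many. *)
  have -> : (fun w => h (grid n w.1, w.2)) @^-1` A = \bigcup_k F k.
    apply/seteqP; split=> [[x y]/= Axy|[x y] [k _ [/= kx Ak]]].
      by exists (Num.floor (x * n.+1%:R)) => //; split=> //=; exact: floor_itv.
    by rewrite /grid (floor_def kx).
  apply: countable_bigcupT_measurable; first exact: countableP.
  move=> k; apply: measurableX; last first.
    by rewrite -[X in measurable X]setTI; exact: continuous_measurable_fun.
  have -> : [set x : R | k%:~R <= x * n.+1%:R < (k + 1)%:~R] =
      (fun x : R => x * n.+1%:R) @^-1` `[k%:~R, (k + 1)%:~R[.
    by apply/seteqP; split=> x /=; rewrite in_itv.
  rewrite -[X in measurable X]setTI.
  have mx : measurable_fun setT (fun x : R => x * n.+1%:R).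
    exact: measurable_funM.
  exact: mx.
move=> [x y] _ /=.
apply: (@cvg_comp _ _ _ (grid ^~ x) (fun x => h (x, y))); last exact: ch1.
apply/cvgrPdist_le => e e0.
near=> n.
have n0 : 0 < n.+1%:R :> R by rewrite ltr0n.
have /andP[f1 f2] := floor_itv (x * n.+1%:R).
rewrite /grid; set k := Num.floor _ in f1 f2 *.
have -> : x - k%:~R / n.+1%:R = (x * n.+1%:R - k%:~R) / n.+1%:R.
  by field; rewrite gt_eqF.
rewrite ger0_norm; last by rewrite divr_ge0 ?subr_ge0 // ltW.
(* The rounding error is below one grid step, [1 / n.+1]. *)
apply: (@le_trans _ _ (harmonic n)).
  rewrite /harmonic ler_pdivrMr// mulVf ?gt_eqF//.
  by move: f2; rewrite intrD; lra.
near: n.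
have /cvgrPdist_le/(_ e e0) := @cvg_harmonic R.
by apply: filterS => n; rewrite sub0r normrN ger0_norm// harmonic_ge0.
Unshelve. all: by end_near.
Qed.

(** Partial derivatives give continuity along horizontal and vertical lines, that is, separate
    continuity. *)
Lemma partially_derivable_measurable {R : realType} (h : R * R -> R) :
  (forall z, derivable h z (1, 0)) -> (forall z, derivable h z (0, 1)) ->
  measurable_fun setT h.
Proof.
move=> d1 d2.
(* The shift by [x] places the base point [z] at parameter [t = x], so that [t] becomes the actual
   coordinate on the line. *)
have line (z v : R * R) x : derivable h z v ->
    {for x, continuous (fun t : R => h ((t - x) *: v + z))}.
  move=> /derivable1P/derivable1_diffP/differentiable_continuous ch.
  apply: (@continuous_comp _ _ _ (fun t : R => t - x)
    (fun t : R => h (t *: v + z))); last by rewrite subrr.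
  by apply: continuousB; [exact: cvg_id|exact: cvg_cst].
apply: separately_continuous_measurable => [y x|x y].
- rewrite (_ : (fun t => _) = fun t => h ((t - x) *: (1, 0) + (x, y))).
    exact: line.
  apply/funext => t; congr (h (_, _)).
    by change (t = (t - x) * 1 + x); rewrite mulr1 subrK.
  by change (y = (t - x) * 0 + y); rewrite mulr0 add0r.
- rewrite (_ : (fun t => _) = fun t => h ((t - y) *: (0, 1) + (x, y))).
    exact: line.
  apply/funext => t; congr (h (_, _)).
    by change (x = (t - y) * 0 + x); rewrite mulr0 add0r.
  by change (t = (t - y) * 1 + y); rewrite mulr1 subrK.
Qed.

Lemma derivable_fst {R : realType} (V W W' : normedModType R)
  (g : V -> W * W') z v : derivable g z v -> derivable (fst \o g) z v.
Proof.
move=> /cvg_ex[l gl]; apply/cvg_ex; exists l.1.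
have c : {for l, continuous (@fst W W')} by case: (l) => a b; exact: cvg_fst.
exact: (continuous_cvg _ c gl).
Qed.

Lemma derivable_snd {R : realType} (V W W' : normedModType R)
  (g : V -> W * W') z v : derivable g z v -> derivable (snd \o g) z v.
Proof.
move=> /cvg_ex[l gl]; apply/cvg_ex; exists l.2.
have c : {for l, continuous (@snd W W')} by case: (l) => a b; exact: cvg_snd.
exact: (continuous_cvg _ c gl).
Qed.

Lemma C1_measurable {R : realType} (g : R * R -> quat R) :
  C1 g -> measurable_fun setT g.
Proof.
move=> [d1 d2 _ _].
have -> : g = fun z => (((g z).1.1.1, (g z).1.1.2, (g z).1.2), (g z).2).
  by apply/funext => z; case: (g z) => [[[]]].
repeat apply: measurable_fun_pair; apply: partially_derivable_measurable => z.
- exact: (derivable_fst (derivable_fst (derivable_fst (d1 z)))).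
- exact: (derivable_fst (derivable_fst (derivable_fst (d2 z)))).
- exact: (derivable_snd (derivable_fst (derivable_fst (d1 z)))).
- exact: (derivable_snd (derivable_fst (derivable_fst (d2 z)))).
- exact: (derivable_snd (derivable_fst (d1 z))).
- exact: (derivable_snd (derivable_fst (d2 z))).
- exact: (derivable_snd (d1 z)).
- exact: (derivable_snd (d2 z)).
Qed.

(** * Invariance of Lebesgue measure and of the surface measure *)

Lemma ge0_integral_measure_preserving d (T : measurableType d) (R : realType)
    (m : {measure set T -> \bar R}) (phi : T -> T) (D : set T)
    (f : T -> \bar R) :
  measurable_fun setT phi ->
  (forall A, measurable A -> pushforward m phi A = m A) ->
  measurable D -> measurable_fun D f -> (forall x, D x -> 0 <= f x)%E ->
  (\int[m]_(x in phi @^-1` D) f (phi x) = \int[m]_(x in D) f x)%E.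
Proof.
move=> mphi phiP mD mf f0.
rewrite -(ge0_integral_pushforward mphi)//; last by move=> x /set_mem; exact: f0.
by apply: eq_measure_integral => A mA _; exact: phiP.
Qed.

Section MeasurePreserving.
Context {R : realType}.
Local Open Scope ereal_scope.
Local Notation mu := (@lebesgue_measure R).
Local Notation mR := (measurableTypeR R).

(** By uniqueness of Lebesgue measure it suffices to compare lengths of half-open intervals. *)
Lemma lebesgue_measure_shift (c : R) (A : set R) : measurable A ->
  pushforward mu (fun x : R => (x + c)%R : measurableTypeR R) A = mu A.
Proof.
move=> mA; apply/esym/lebesgue_measure_unique => //= [|_ _ [[a b]] _ <-].
  exact: measurable_funD.
rewrite /pushforward (_ : _ @^-1` _ = `](a - c)%R, (b - c)%R]%classic).
  rewrite !lebesgue_measure_itv/= !lte_fin ltrD2r.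
  by case: ifP => // _; rewrite -!EFinB; congr EFin; ring.
by apply/seteqP; split=> x /=; rewrite !in_itv/= ltrBlDr lerBrDr.
Qed.

(** The reflection is a negation followed by a shift, and both preserve the measure. *)
Lemma lebesgue_measure_reflect (c : R) (A : set R) : measurable A ->
  pushforward mu (fun x : R => (c - x)%R : measurableTypeR R) A = mu A.
Proof.
move=> mA.
have mS : measurable ((fun x : R => (x + c)%R) @^-1` A).
  by rewrite -[X in measurable X]setTI; apply: measurable_funD.
rewrite -(lebesgue_measure_shift c mA) /pushforward -(lebesgue_measureN mS).
rewrite /pushforward; congr (mu _).
by apply/seteqP; split=> x /=; rewrite addrC.
Qed.

(** A product measure is determined by its values on rectangles, and the preimage of a rectangle is
    the rectangle of the preimages. *)
Lemma lebesgue2_pushforward (s t : mR -> mR) (A : set (mR * mR)) :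
  measurable_fun setT s -> measurable_fun setT t ->
  (forall B, measurable B -> pushforward mu s B = mu B) ->
  (forall B, measurable B -> pushforward mu t B = mu B) ->
  measurable A ->
  pushforward lebesgue2 (fun w : mR * mR => (s w.1, t w.2)) A = lebesgue2 A.
Proof.
move=> ms mt ps pt mA.
pose st (w : mR * mR) : mR * mR := (s w.1, t w.2).
have mst : measurable_fun setT st.
  apply: measurable_fun_pair => /=.
    exact: (measurableT_comp ms measurable_fst).
  exact: (measurableT_comp mt measurable_snd).
(* The pushforward is packaged as a measure, as the uniqueness result requires; this structure rests
   on [mst]. *)
have [m' m'E] : exists m' : {measure set _ -> \bar R},
    pushforward lebesgue2 st = m'.
  by unshelve (eexists; reflexivity); exact: mst.
transitivity (m' A); first by rewrite -m'E.
apply/esym/product_measure_unique => // B C mB mC.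
transitivity (mu (s @^-1` B) * mu (t @^-1` C)); last first.
  by congr (_ * _); [exact: ps|exact: pt].
rewrite -m'E /pushforward -product_measure1E//.
- by rewrite -[X in measurable X]setTI; exact: ms.
- by rewrite -[X in measurable X]setTI; exact: mt.
Qed.

Lemma integral_lebesgue2_comp (s t : mR -> mR) (D : set (mR * mR))
    (f : mR * mR -> \bar R) :
  measurable_fun setT s -> measurable_fun setT t ->
  (forall B, measurable B -> pushforward mu s B = mu B) ->
  (forall B, measurable B -> pushforward mu t B = mu B) ->
  measurable D -> measurable_fun D f -> (forall w, D w -> 0 <= f w) ->
  \int[lebesgue2]_(w in (fun w : mR * mR => (s w.1, t w.2)) @^-1` D) f (s w.1, t w.2) =
  \int[lebesgue2]_(w in D) f w.
Proof.
move=> ms mt ps pt mD mf f0.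
have mst : measurable_fun setT (fun w : mR * mR => (s w.1, t w.2)).
  apply: measurable_fun_pair => /=.
    exact: (measurableT_comp ms measurable_fst).
  exact: (measurableT_comp mt measurable_snd).
apply: (@ge0_integral_measure_preserving _ _ R lebesgue2 _ _ _ mst) => // A mA.
exact: lebesgue2_pushforward.
Qed.

(** The product is infinity times zero, which is zero by convention. *)
Lemma lebesgue2_horizontal_line (a : R) : lebesgue2 (setT `*` [set a]) = 0.
Proof.
transitivity (mu setT * mu [set a]); first exact: product_measure1E.
by rewrite lebesgue_measure_set1 mule0.
Qed.

Lemma measurable_preimageT d d' (T : measurableType d) (T' : measurableType d')
    (f : T -> T') (A : set T') :
  measurable_fun setT f -> measurable A -> measurable (f @^-1` A).
Proof. by move=> mf mA; rewrite -[X in measurable X]setTI; exact: mf. Qed.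

Lemma sphere_density_ge0 (w : R * R) : `[0%R, pi]%classic w.1 ->
  0 <= (sin w.1 / (4 * pi))%:E.
Proof.
move=> /=; rewrite in_itv => /sin_ge0_pi s0.
by rewrite lee_fin divr_ge0// mulr_ge0// pi_ge0.
Qed.

Lemma measurable_sphere_density :
  measurable_fun setT (fun w : R * R => (sin w.1 / (4 * pi))%:E).
Proof.
apply/measurable_EFinP; apply: measurable_funM => //.
apply: (measurableT_comp (f := sin)); last exact: measurable_fst.
by apply: continuous_measurable_fun; exact: continuous_sin.
Qed.

(* Up to a null set, the parameter rectangle is the disjoint union of two
   halves, which the antipodal map exchanges. *)
Lemma sphere_measure_halves (A : set (quat R)) : measurable A ->
  sphere_measure A =
  \int[lebesgue2]_(w in (`[0%R, pi] `*` `[0%R, pi[) `&` sphere_param @^-1` A)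
    (sin w.1 / (4 * pi))%:E +
  \int[lebesgue2]_(w in (`[0%R, pi] `*` `[pi, (pi + pi)%R[) `&` sphere_param @^-1` A)
    (sin w.1 / (4 * pi))%:E.
Proof.
move=> mA; rewrite /sphere_measure.
have mP := measurable_preimageT measurable_sphere_param mA.
have pp : (pi + pi = 2 * pi :> R)%R by ring.
have mI (a b : bool) (x y : R) : measurable ((`[0%R, pi]%classic `*`
    [set` Interval (BSide a x) (BSide b y)]) `&` sphere_param @^-1` A).
  by apply: measurableI => //; exact: measurableX.
(* Dropping the edge [phi = 2 * pi] makes both halves half-open, so that a shift by [pi] matches
   them exactly. *)
rewrite (@ge0_negligible_integral _ _ _ lebesgue2 _ (setT `*` [set (2 * pi)%R]))//=.
- rewrite -ge0_integral_setU//=.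
  + congr integral; apply/seteqP; split=> [[x y]|[x y]] /=; rewrite !in_itv/=.
      move=> [[[xpi /andP[y0 y1]] Pxy] ny].
      have [ypi|ypi] := ltP y pi; [left|right]; split=> //; split=> //.
        by rewrite y0.
      rewrite pp lt_neqAle y1 andbT.
      by apply/eqP => e; apply: ny; split.
    have pi0 := @pi_gt0 R.
    by move=> [|] [[xpi /andP[y0 y1]] Pxy]; (split; [split=> //; split=> //|]);
      try (by apply/andP; split; lra); move=> [_ e]; lra.
  + exact: mI.
  + exact: mI.
  + by apply: measurable_funTS; exact: measurable_sphere_density.
  + by move=> w [|] [[w1 _] _]; exact: sphere_density_ge0.
  + rewrite disj_set2E; apply/eqP/seteqP; split=> // -[x y] /=.
    rewrite !in_itv/= => -[[[_ /andP[_ y1]] _] [[_ /andP[y2 _]] _]].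
    by move: y1; rewrite ltNge y2.
- exact: measurableX.
- exact: mI.
- by apply: measurable_funTS; exact: measurable_sphere_density.
- by move=> w [[w1 _] _]; exact: sphere_density_ge0.
- exact: lebesgue2_horizontal_line.
Qed.

Lemma measurable_qre : measurable_fun setT (@qre R).
Proof.
exact: (measurableT_comp measurable_fst (measurableT_comp measurable_fst measurable_fst)).
Qed.

Lemma measurable_qi : measurable_fun setT (@qi R).
Proof.
exact: (measurableT_comp measurable_snd (measurableT_comp measurable_fst measurable_fst)).
Qed.

Lemma measurable_qj : measurable_fun setT (@qj R).
Proof. exact: (measurableT_comp measurable_snd measurable_fst). Qed.

Lemma measurable_qk : measurable_fun setT (@qk R).
Proof. exact: measurable_snd. Qed.

Lemma measurable_qopp : measurable_fun setT (-%R : quat R -> quat R).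
Proof.
rewrite (_ : -%R = fun q : quat R =>
  (- qre q, - qi q, - qj q, - qk q)%R); last by apply/funext => -[[[]]].
repeat apply: measurable_fun_pair; apply: measurable_funN.
- exact: measurable_qre.
- exact: measurable_qi.
- exact: measurable_qj.
- exact: measurable_qk.
Qed.

Lemma sphere_measureN (A : set (quat R)) : measurable A ->
  sphere_measure (-%R @^-1` A) = sphere_measure A.
Proof.
have mmid c : measurable_fun setT (fun x : mR => c - x)%R.
  exact: measurable_funB.
have msft c : measurable_fun setT (fun x : mR => x + c)%R.
  exact: measurable_funD.
move=> mA.
have mP := measurable_preimageT measurable_sphere_param mA.
have mI (a b : bool) (x y : R) : measurable ((`[0%R, pi]%classic `*`
    [set` Interval (BSide a x) (BSide b y)]) `&` sphere_param @^-1` A).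
  by apply: measurableI => //; exact: measurableX.
have md (D : set (mR * mR)) :
    measurable_fun D (fun w : mR * mR => (sin w.1 / (4 * pi))%:E).
  by apply: measurable_funTS; exact: measurable_sphere_density.
have mNA : measurable (-%R @^-1` A : set (quat R)).
  exact: measurable_preimageT measurable_qopp mA.
(* In spherical coordinates the antipodal map is
   (theta, phi) |-> (pi - theta, phi + e), with e = pi on one half of the
   rectangle and e = - pi on the other. *)
have spi (x : R) : sin (pi - x)%R = sin x by rewrite addrC sinDpi sinN opprK.
have cpi (x : R) : cos (pi - x)%R = (- cos x)%R by rewrite addrC cosDpi cosN.
have exch (a b c d e : R) : (c + e = a)%R -> (d + e = b)%R ->
    (forall x, sin (x + e) = - sin x)%R -> (forall x, cos (x + e) = - cos x)%R ->
  \int[lebesgue2]_(w in (`[0%R, pi] `*` `[c, d[) `&` sphere_param @^-1` (-%R @^-1` A))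
    (sin w.1 / (4 * pi))%:E =
  \int[lebesgue2]_(w in (`[0%R, pi] `*` `[a, b[) `&` sphere_param @^-1` A)
    (sin w.1 / (4 * pi))%:E.
  move=> ca db se ce.
  transitivity (\int[lebesgue2]_(w in (fun w : mR * mR => (pi - w.1, w.2 + e)%R)
      @^-1` ((`[0%R, pi] `*` `[a, b[) `&` sphere_param @^-1` A))
      (sin (pi - w.1) / (4 * pi))%:E); last first.
    apply: (@integral_lebesgue2_comp (fun x => pi - x)%R (fun x => x + e)%R _
      (fun w : mR * mR => (sin w.1 / (4 * pi))%:E)) => //.
    - exact: mmid.
    - exact: msft.
    - by move=> B; exact: lebesgue_measure_reflect.
    - by move=> B; exact: lebesgue_measure_shift.
    - exact: mI.
    - by move=> w [[w1 _] _]; exact: sphere_density_ge0.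
  (* The density is unchanged under reflection of the polar angle. *)
  under [RHS]eq_integral do rewrite spi.
  congr integral; apply/seteqP; split=> -[x y] /=; rewrite !in_itv/=.
    move=> [[/andP[x0 x1] /andP[y0 y1]]]; rewrite /sphere_param/=.
    rewrite spi cpi se ce !mulrN => PA; split; last first.
      by move: PA; congr (A _); congr (_, _, _, _); rewrite oppr0.
    by split; apply/andP; split; lra.
  move=> [[/andP[x0 x1] /andP[y0 y1]]]; rewrite /sphere_param/=.
  rewrite spi cpi se ce !mulrN => PA; split; last first.
    by move: PA; congr (A _); congr (_, _, _, _); rewrite oppr0.
  by split; apply/andP; split; lra.
(* Swapping the summands pairs each half for the reflected set with the opposite half for [A]. *)
rewrite !sphere_measure_halves// addeC; congr (_ + _).
  apply: (exch _ _ _ _ (- pi)%R); rewrite ?subrr ?addrK// => x.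
    by rewrite -[in RHS](subrK pi x) sinDpi opprK.
  by rewrite -[in RHS](subrK pi x) cosDpi opprK.
by apply: (exch _ _ _ _ pi) => //; [rewrite add0r|exact: sinDpi|exact: cosDpi].
Qed.

End MeasurePreserving.

(** * Measurability of slice regular functions *)

Section QuatMeasurable.
Context {R : realType}.

Lemma measurable_quat d (T : measurableType d) (f : T -> quat R) :
  measurable_fun setT (qre \o f) -> measurable_fun setT (qi \o f) ->
  measurable_fun setT (qj \o f) -> measurable_fun setT (qk \o f) ->
  measurable_fun setT f.
Proof.
move=> m0 m1 m2 m3.
have -> : f = fun x => (qre (f x), qi (f x), qj (f x), qk (f x)).
  by apply/funext => x; case: (f x) => [[[]]].
by do !apply: measurable_fun_pair.
Qed.

Lemma measurable_qcomp d (T : measurableType d) (f : T -> quat R) :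
  measurable_fun setT f ->
  [/\ measurable_fun setT (fun x => qre (f x)),
      measurable_fun setT (fun x => qi (f x)),
      measurable_fun setT (fun x => qj (f x)) &
      measurable_fun setT (fun x => qk (f x))].
Proof.
move=> mf; split.
- exact: (measurableT_comp measurable_qre mf).
- exact: (measurableT_comp measurable_qi mf).
- exact: (measurableT_comp measurable_qj mf).
- exact: (measurableT_comp measurable_qk mf).
Qed.

Lemma measurable_qadd d (T : measurableType d) (f g : T -> quat R) :
  measurable_fun setT f -> measurable_fun setT g ->
  measurable_fun setT (fun x => f x + g x).
Proof.
move=> /measurable_qcomp[f0 f1 f2 f3] /measurable_qcomp[g0 g1 g2 g3].
by apply: measurable_quat; exact: measurable_funD.
Qed.

Lemma measurable_qmul d (T : measurableType d) (f g : T -> quat R) :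
  measurable_fun setT f -> measurable_fun setT g ->
  measurable_fun setT (fun x => qmul (f x) (g x)).
Proof.
move=> /measurable_qcomp[f0 f1 f2 f3] /measurable_qcomp[g0 g1 g2 g3].
apply: measurable_quat; rewrite /comp /qmul/=;
  repeat (first [apply: measurable_funB | apply: measurable_funD |
    apply: measurable_funM]); by [].
Qed.

Lemma measurable_qabs : measurable_fun setT (@qabs R).
Proof.
apply: (measurableT_comp (f := @Num.sqrt R)).
  by apply: continuous_measurable_fun => x; exact: sqrt_continuous.
by repeat apply: measurable_funD; apply: measurable_funX;
  [exact: measurable_qre|exact: measurable_qi|exact: measurable_qj|exact: measurable_qk].
Qed.

Lemma measurable_fock_integrand (p alpha : R) (f : quat R -> quat R) :
  measurable_fun setT f -> measurable_fun setT (fock_integrand p alpha f).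
Proof.
move=> mf; rewrite /fock_integrand; apply/measurable_EFinP.
apply: (measurableT_comp (f := fun x : R => x `^ p)).
  exact: measurable_powR.
apply: measurable_funM.
  exact: (measurableT_comp measurable_qabs mf).
apply: (measurableT_comp (@measurable_expR R)).
apply: measurable_funM => //; apply: measurable_funM => //.
by apply: measurable_funX; exact: measurable_qabs.
Qed.

Lemma measurable_slice_point : measurable_fun setT
  (fun w : quat R * (R * R) => slice_point w.1 w.2).
Proof.
have [m0 m1 m2 m3] := measurable_qcomp (@measurable_fst _ _ (quat R) (R * R)%type).
have mx : measurable_fun setT (fun w : quat R * (R * R) => w.2.1).
  exact: (measurableT_comp measurable_fst measurable_snd).
have my : measurable_fun setT (fun w : quat R * (R * R) => w.2.2).
  exact: (measurableT_comp measurable_snd measurable_snd).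
apply: measurable_quat; apply: measurable_funD => //=;
  by apply: measurable_funM.
Qed.

Lemma measurable_slice_pointr (I : quat R) : measurable_fun setT (slice_point I).
Proof.
have mI : measurable_fun setT (fun z : R * R => (I, z)).
  by apply: measurable_fun_pair => //; exact: measurable_id.
exact: (measurableT_comp measurable_slice_point mI).
Qed.

(** Every [q] is its real part plus [n q] times the direction [J q], so [f] is built from its two
    measurable components composed with the measurable maps [P] and [J]. *)
Lemma slice_regular_measurable (f : quat R -> quat R) :
  slice_regular f -> measurable_fun setT f.
Proof.
move=> [f0 [f1 [[f0e f1o fE] /C1_measurable m0 /C1_measurable m1 _]]].
pose n (q : quat R) : R := Num.sqrt (qi q ^+ 2 + qj q ^+ 2 + qk q ^+ 2).
pose J (q : quat R) : quat R := (0, qi q / n q, qj q / n q, qk q / n q).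
pose P (q : quat R) : R * R := (qre q, n q).
have -> : f = fun q => f0 (P q) + qmul (J q) (f1 (P q)).
  apply/funext => q.
  have s0 : 0 <= qi q ^+ 2 + qj q ^+ 2 + qk q ^+ 2 by rewrite !addr_ge0// sqr_ge0.
  have n2 : n q ^+ 2 = qi q ^+ 2 + qj q ^+ 2 + qk q ^+ 2 by rewrite sqr_sqrtr.
  have [n0|n0] := eqVneq (n q) 0; last first.
    rewrite -fE; last first.
      apply/imag_sphereP; split=> //; rewrite /J /qi/qj/qk/=.
      rewrite !expr_div_n -!mulrDl -n2 divff// expf_neq0//.
    congr f; move: n0; rewrite /J /P.
    case: q {s0 n2} => [[[a b] c] d]; rewrite slice_pointE /qre/qi/qj/qk/= => n0.
    by rewrite mulr0 addr0 !(mulrC (n _)) !divfK.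
  (* On the real axis division by zero makes [J q] zero, which is not in the sphere; the formula
     survives because [f1] is odd in its second variable and so vanishes there. *)
  have f10 : f1 (P q) = 0.
    rewrite /P n0.
    have := f1o (qre q) 0; rewrite oppr0.
    case: (f1 _) => [[[a b] c] d] [*]; congr (_, _, _, _); lra.
  rewrite n0 expr0n/= in n2.
  have {n2}[qi0 qj0 qk0] : [/\ qi q = 0, qj q = 0 & qk q = 0].
    have := sqr_ge0 (qi q); have := sqr_ge0 (qj q); have := sqr_ge0 (qk q).
    by split; apply/eqP; rewrite -sqrf_eq0; apply/eqP; lra.
  have I0 : imag_sphere ((0, 1, 0, 0) : quat R).
    by apply/imag_sphereP; rewrite /qre/qi/qj/qk/=; split=> //; ring.
  transitivity (f (slice_point (0, 1, 0, 0) (P q))); last first.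
    rewrite fE// f10; congr (_ + _).
    by rewrite /qmul/qre/qi/qj/qk/=; congr (_, _, _, _); ring.
  congr f; move: qi0 qj0 qk0; rewrite /slice_point /P n0 scale0r addr0.
  by case: q {s0 n0 f10} => [[[a b] c] d]; rewrite /qi/qj/qk/= => -> -> ->.
have mn : measurable_fun setT n.
  apply: (measurableT_comp (f := @Num.sqrt R)).
    by apply: continuous_measurable_fun => x; exact: sqrt_continuous.
  by repeat apply: measurable_funD; apply: measurable_funX;
    [exact: measurable_qi|exact: measurable_qj|exact: measurable_qk].
have mnV : measurable_fun setT (fun q => (n q)^-1).
  (* The inverse is a real power, also at [n q = 0], where both are zero by convention. *)
  rewrite (_ : (fun q => _) = fun q => n q `^ (-1)).
    apply: (measurableT_comp (f := fun x : R => x `^ (-1))); last exact: mn.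
    exact: measurable_powR.
  by apply/funext => q; rewrite powR_inv1// sqrtr_ge0.
have mP : measurable_fun setT P.
  by apply: measurable_fun_pair => //; exact: measurable_qre.
have mJ : measurable_fun setT J.
  have mq (h : quat R -> R) : measurable_fun setT h ->
      measurable_fun setT (fun q => h q / n q).
    by move=> mh; exact: measurable_funM.
  apply: measurable_quat; first exact: measurable_cst.
  - exact: (mq _ measurable_qi).
  - exact: (mq _ measurable_qj).
  - exact: (mq _ measurable_qk).
apply: measurable_qadd; first exact: (measurableT_comp m0 mP).
by apply: measurable_qmul => //; exact: (measurableT_comp m1 mP).
Qed.

End QuatMeasurable.

(** * Slice and global integrals over the upper half-plane *)

(** The complement of [D] is null for the restricted measure, and on subsets of [D] the two measures
    agree. *)
Lemma ge0_integral_mrestr d (T : measurableType d) (R : realType)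
    (m : {measure set T -> \bar R}) (D : set T) (mD : measurable D)
    (f : T -> \bar R) :
  measurable_fun setT f -> (forall x, 0 <= f x)%E ->
  (\int[mrestr m mD]_x f x = \int[m]_(x in D) f x)%E.
Proof.
move=> mf f0; transitivity (\int[mrestr m mD]_(x in D) f x)%E.
  have mN0 : mrestr m mD (~` D) = 0 by rewrite /mrestr setICl measure0.
  by rewrite (ge0_negligible_integral _ _ _ _ mN0)// ?setTD ?setCK//;
    exact: measurableC.
by apply: eq_measure_integral => A mA AD; rewrite /= /mrestr setIidl.
Qed.

Lemma ge0_integral_pushforward_mrestr d d' (T : measurableType d)
    (T' : measurableType d') (R : realType) (m : {measure set T -> \bar R})
    (D : set T) (mD : measurable D) (phi : T -> T') (f : T' -> \bar R) :
  measurable_fun setT phi -> measurable_fun setT f -> (forall y, 0 <= f y)%E ->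
  (\int[pushforward (mrestr m mD) phi]_y f y = \int[m]_(x in D) f (phi x))%E.
Proof.
move=> mphi mf f0; rewrite (ge0_integral_pushforward mphi)//.
have mfphi := measurableT_comp mf mphi.
exact: (ge0_integral_mrestr m mD mfphi (fun x => f0 (phi x))).
Qed.

(** This is Tonelli for [g] extended by zero outside the rectangle; the inner integral vanishes for
    [y] outside [B]. *)
Lemma ge0_integral_setX d1 d2 (T1 : measurableType d1) (T2 : measurableType d2)
    (R : realType) (m1 : {sigma_finite_measure set T1 -> \bar R})
    (m2 : {sigma_finite_measure set T2 -> \bar R}) (A : set T1) (B : set T2)
    (g : T1 * T2 -> \bar R) :
  measurable A -> measurable B -> measurable_fun setT g ->
  (forall w, 0 <= g w)%E ->
  (\int[m1 \x m2]_(w in A `*` B) g w =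
   \int[m2]_(y in B) \int[m1]_(x in A) g (x, y))%E.
Proof.
move=> mA mB mg g0.
have mAB : measurable (A `*` B) by exact: measurableX.
rewrite integral_mkcond (@fubini_tonelli2 _ _ _ _ R m1 m2)//=; last 2 first.
- exact/(measurable_restrictT _ _).1/measurable_funTS.
- by move=> w; rewrite erestrict_ge0.
rewrite [RHS]integral_mkcond; apply: eq_integral => y _.
rewrite /fubini_G [RHS]patchE; case: ifPn => yB.
  rewrite [RHS]integral_mkcond; apply: eq_integral => x _.
  rewrite !patchE; congr (if _ then _ else _).
  apply/idP/idP; rewrite !inE /=; first by case.
  by move=> ?; split=> //; rewrite inE in yB.
apply: integral0_eq => x _; rewrite patchE ifF//; apply/negbTE.
by apply: contra yB; rewrite !inE => -[].
Qed.

Section Integrals.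
Context {R : realType}.
Local Notation mR := (measurableTypeR R).

Definition upper_half_plane : set (R * R) := [set z | (0 < z.2)%R].

Lemma measurable_upper_half_plane : measurable upper_half_plane.
Proof.
rewrite (_ : upper_half_plane = snd @^-1` `]0%R, +oo[); last first.
  by apply/seteqP; split=> z; rewrite /upper_half_plane/= in_itv/= andbT.
exact: (measurable_preimageT measurable_snd).
Qed.

Lemma measurable_imag_sphere : measurable (@imag_sphere R).
Proof.
rewrite (_ : imag_sphere = (@qre R) @^-1` [set 0%R] `&`
    (fun q : quat R => qi q ^+ 2 + qj q ^+ 2 + qk q ^+ 2)%R @^-1` [set 1%R]).
  apply: measurableI.
    by apply: (measurable_preimageT measurable_qre); exact: measurable_set1.
  apply: measurable_preimageT; last exact: measurable_set1.
  by repeat apply: measurable_funD; apply: measurable_funX;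
    [exact: measurable_qi|exact: measurable_qj|exact: measurable_qk].
by apply/seteqP; split=> q /imag_sphereP.
Qed.

(* The plane is cut out by the vanishing of the distance to the orthogonal
   projection. *)
Lemma measurable_slice_plane (I : quat R) : imag_sphere I ->
  measurable (slice_plane I).
Proof.
move=> hI.
pose P (q : quat R) : R * R :=
  (qre q, qi q * qi I + qj q * qj I + qk q * qk I)%R.
have mP : measurable_fun setT P.
  apply: measurable_fun_pair; first exact: measurable_qre.
  by repeat apply: measurable_funD; apply: measurable_funM => //;
    [exact: measurable_qi|exact: measurable_qj|exact: measurable_qk].
pose h q := qabs (q + - slice_point I (P q)).
have mh : measurable_fun setT h.
  apply: (measurableT_comp measurable_qabs); apply: measurable_qadd.
    exact: measurable_id.
  apply: (measurableT_comp measurable_qopp).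
  exact: (measurableT_comp (measurable_slice_pointr I) mP).
rewrite (_ : slice_plane I = h @^-1` [set 0%R]); last first.
  apply/seteqP; split=> [_ [[x y] _ <-]|q].
    have PE : P (slice_point I (x, y)) = (x, y).
      move: hI => /imag_sphereP[]; case: I @P {mP h mh} => [[[a b] c] d] P.
      rewrite /P slice_pointE /qre/qi/qj/qk/= => -> e.
      congr (_, _); first by rewrite mulr0 addr0.
      by rewrite -[RHS]mulr1 -e; ring.
    change (h (slice_point I (x, y)) = 0).
    rewrite /h PE subrr /qabs /qre/qi/qj/qk/=.
    by rewrite expr0n/= !addr0 sqrtr0.
  move=> hq; exists (P q) => //; apply/esym/eqP; rewrite -subr_eq0; apply/eqP.
  exact: qabs_eq0.
by apply: (measurable_preimageT mh); exact: measurable_set1.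
Qed.

Local Open Scope ereal_scope.

Variable F : quat R -> \bar R.
Hypothesis mF : measurable_fun setT F.
Hypothesis F0 : forall q, 0 <= F q.

Let mFs (I : quat R) : measurable_fun setT (fun z : mR * mR => F (slice_point I z)).
Proof. exact: (measurableT_comp mF (measurable_slice_pointr I)). Qed.

(** The real axis is null, and the reflection of [y] carries the lower half-plane to the upper one
    while replacing [I] by [- I]. *)
Lemma slice_integralE (I : quat R) : imag_sphere I ->
  \int[plane_measure I]_(z in slice_plane I) F z =
  \int[lebesgue2]_(z in upper_half_plane)
    (F (slice_point I z) + F (slice_point (- I)%R z)).
Proof.
move=> hI.
have mU : measurable (upper_half_plane : set (mR * mR)).
  exact: measurable_upper_half_plane.
(* The form [0 - w.2] matches [lebesgue_measure_reflect] at [c = 0]. *)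
have mL : measurable (((fun w : mR * mR => (w.1, 0 - w.2)%R) @^-1`
    upper_half_plane) : set (mR * mR)).
  apply: measurable_preimageT mU; apply: measurable_fun_pair => /=.
    exact: measurable_fst.
  by apply: measurable_funB => //; exact: measurable_snd.
transitivity (\int[lebesgue2]_(z in setT) F (slice_point I z)).
  rewrite (_ : setT = slice_point I @^-1` slice_plane I); last first.
    by apply/seteqP; split=> // z _; exists z.
  have msp : measurable_fun setT (slice_point I : mR * mR -> quat R).
    exact: measurable_slice_pointr.
  apply: (@ge0_integral_pushforward _ _ _ _ R _ msp lebesgue2) => //.
    exact: measurable_slice_plane.
  exact: measurable_funTS.
rewrite (@ge0_negligible_integral _ _ _ lebesgue2 _ (setT `*` [set 0%R]))//; last 2 first.
- exact: measurableX.
- exact: lebesgue2_horizontal_line.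
rewrite (_ : _ `\` _ = upper_half_plane `|`
    (fun w : mR * mR => (w.1, 0 - w.2)%R) @^-1` upper_half_plane); last first.
  apply/seteqP; split=> -[x y]; rewrite /upper_half_plane /= sub0r oppr_gt0.
    by move=> [_ h]; apply/orP; rewrite orbC -neq_lt; apply/eqP => y0; apply: h.
  by move=> h; split=> // -[_ y0]; move: h; rewrite y0 ltxx => -[].
rewrite ge0_integral_setU//; last 2 first.
- exact: measurable_funTS.
- rewrite disj_set2E; apply/eqP/seteqP; split=> // -[x y].
  rewrite /upper_half_plane /= sub0r oppr_gt0 => -[y0 y1].
  by have := lt_trans y0 y1; rewrite ltxx.
rewrite ge0_integralD//; last 2 first.
- exact: measurable_funTS.
- exact: measurable_funTS.
congr (_ + _).
rewrite -(@integral_lebesgue2_comp R id (fun y => 0 - y)%R _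
  (fun z => F (slice_point (- I)%R z)))//; last 3 first.
- exact: measurable_funB.
- by move=> B; exact: lebesgue_measure_reflect.
- exact: measurable_funTS.
apply: eq_integral => -[x y] _; congr F.
by rewrite /slice_point/= sub0r scalerN scaleNr opprK.
Qed.

Lemma global_integralE :
  \int[quat_measure]_(q in setT) F q =
  \int[lebesgue2]_(z in upper_half_plane)
    \int[sphere_measure]_(J in imag_sphere) F (slice_point J z).
Proof.
pose g (w : quat R * (mR * mR)) := F (slice_point w.1 w.2).
have mg : measurable_fun setT g.
  exact: (measurableT_comp mF measurable_slice_point).
have mD : measurable (imag_sphere `*` upper_half_plane : set (quat R * (mR * mR))).
  by apply: measurableX;
    [exact: measurable_imag_sphere|exact: measurable_upper_half_plane].
pose m12 : {measure set (quat R * (mR * mR)) -> \bar R} :=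
  sphere_measure \x lebesgue2.
(* Seen as the image of a restricted product measure, [quat_measure] falls under the change of
   variables, and Tonelli then applies. *)
have quatE : quat_measure = pushforward (mrestr m12 mD)
    (fun w : quat R * (mR * mR) => slice_point w.1 w.2).
  apply/funext => A; rewrite /quat_measure setIC /pushforward.
  reflexivity.
rewrite quatE.
transitivity (\int[m12]_(w in (imag_sphere `*` upper_half_plane)) g w).
  have msp : measurable_fun setT
      (fun w : quat R * (mR * mR) => slice_point w.1 w.2).
    exact: measurable_slice_point.
  exact: (@ge0_integral_pushforward_mrestr _ _ _ _ R m12 _ mD _ F msp mF F0).
have g0 w : 0 <= g w by exact: F0.
exact: (@ge0_integral_setX _ _ _ _ R sphere_measure lebesgue2 _ _ g
  measurable_imag_sphere measurable_upper_half_plane mg g0).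
Qed.

End Integrals.

(** * Comparison of the norms *)

Section Comparison.
Context {R : realType}.
Local Open Scope ereal_scope.
Local Notation mR := (measurableTypeR R).

(** Spherical coordinates take all their values in the sphere, so it carries the whole mass. *)
Lemma sphere_measure_imag_sphere : sphere_measure (@imag_sphere R) = 1.
Proof.
rewrite -(probability_setT (@sphere_measure R)) /= /sphere_measure.
congr integral; congr (_ `&` _); apply/seteqP; split=> // w _ /=.
apply/imag_sphereP; rewrite /sphere_param /qre/qi/qj/qk/=; split=> //.
rewrite !exprMn -mulrDr (addrC (cos w.2 ^+ 2)%R) !(addrC (sin _ ^+ 2)%R).
by rewrite cos2Dsin2 mulr1 addrC cos2Dsin2.
Qed.

Variable F : quat R -> \bar R.
Hypothesis mF : measurable_fun setT F.
Hypothesis F0 : forall q, 0 <= F q.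

Let mFJ (z : R * R) : measurable_fun setT (fun J => F (slice_point J z)).
Proof.
have mz : measurable_fun setT (fun J : quat R => (J, z)).
  by apply: measurable_fun_pair => //; exact: measurable_id.
exact: (measurableT_comp mF (measurableT_comp measurable_slice_point mz)).
Qed.

Let sphere_integral_opp (z : R * R) :
  \int[sphere_measure]_(J in imag_sphere) F (slice_point (- J)%R z) =
  \int[sphere_measure]_(J in imag_sphere) F (slice_point J z).
Proof.
have SN : imag_sphere = -%R @^-1` imag_sphere :> set (quat R).
  apply/seteqP; split=> J /=; first exact: imag_sphereN.
  by move=> /imag_sphereN; rewrite opprK.
rewrite [in LHS]SN.
apply: (@ge0_integral_measure_preserving _ (quat R) R sphere_measure -%R
  imag_sphere (fun J => F (slice_point J z)) measurable_qopp) => //; last first.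
- exact: measurable_funTS.
- exact: measurable_imag_sphere.
- exact: sphere_measureN.
Qed.

Let measurable_sphere_integral :
  measurable_fun setT (fun z : mR * mR =>
    \int[sphere_measure]_(J in imag_sphere) F (slice_point J z)).
Proof.
pose g (w : quat R * (mR * mR)) := F (slice_point w.1 w.2).
pose D : set (quat R * (mR * mR)) := imag_sphere `*` setT.
have mg : measurable_fun setT (g \_ D).
  apply/(measurable_restrictT _ _).1.
    by apply: measurableX => //; exact: measurable_imag_sphere.
  apply: measurable_funTS; exact: (measurableT_comp mF measurable_slice_point).
have g0 w : 0 <= (g \_ D) w by apply: erestrict_ge0 => ? _; exact: F0.
(* It is a partial integral of a nonnegative jointly measurable function, measurable by Tonelli. *)
rewrite (_ : (fun z => _) = fubini_G sphere_measure (g \_ D)).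
  exact: (@measurable_fun_fubini_tonelli_G _ _ _ _ R sphere_measure _ mg g0).
apply/funext => z; rewrite [LHS]integral_mkcond.
rewrite /fubini_G; apply: eq_integral => J _.
rewrite !patchE; congr (if _ then _ else _).
by apply/idP/idP; rewrite !inE /D /=; [move=> ?; split|case].
Qed.

(** The sphere has mass one, so a bound uniform in [J] and [J'] may be averaged over either
    direction and then integrated over the half-plane. The global integral is doubled because a
    slice meets both [I] and [- I]. *)
Lemma compare_slice_global (K : R) (I : quat R) : (0 <= K)%R -> imag_sphere I ->
  (forall J J' z, imag_sphere J -> imag_sphere J' ->
    F (slice_point J z) + F (slice_point (- J)%R z) <=
    K%:E * (F (slice_point J' z) + F (slice_point (- J')%R z))) ->
  let S := \int[plane_measure I]_(z in slice_plane I) F z in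
  let G := \int[quat_measure]_(q in setT) F q in
  G + G <= K%:E * S /\ S <= K%:E * (G + G).
Proof.
move=> K0 hI hK S G; rewrite {}/S {}/G slice_integralE// global_integralE//.
set h := fun z : mR * mR =>
  \int[sphere_measure]_(J in imag_sphere) F (slice_point J z).
pose A (J : quat R) (z : mR * mR) :=
  F (slice_point J z) + F (slice_point (- J)%R z).
have h0 z : 0 <= h z by apply: integral_ge0.
have A0 J z : 0 <= A J z by rewrite adde_ge0.
have mA J : measurable_fun setT (A J).
  by apply: emeasurable_funD;
    exact: (measurableT_comp mF (measurable_slice_pointr _)).
have mS := @measurable_imag_sphere R.
have mU : measurable (upper_half_plane : set (mR * mR)).
  exact: measurable_upper_half_plane.
have mh : measurable_fun setT h by exact: measurable_sphere_integral.
(* One of the two copies of [h z] is replaced by its antipodal version. *)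
have hh z : h z + h z = \int[sphere_measure]_(J in imag_sphere) A J z.
  rewrite ge0_integralD//; first by rewrite sphere_integral_opp.
    exact: measurable_funTS.
  by apply: measurable_funTS; exact: (measurableT_comp (mFJ z) measurable_qopp).
have cst_int (c : \bar R) : \int[sphere_measure]_(J in imag_sphere) (cst c) J = c.
  transitivity (c * sphere_measure (@imag_sphere R)); first exact: integral_cst.
  by rewrite sphere_measure_imag_sphere mule1.
have mAJ z : measurable_fun imag_sphere (A ^~ z).
  apply: emeasurable_funD; apply: measurable_funTS; first exact: mFJ.
  exact: (measurableT_comp (mFJ z) measurable_qopp).
(* Here [hK] is averaged over its first direction, and in [le2] over its second, the other one being
   [I]. *)
have le1 z : h z + h z <= K%:E * A I z.
  rewrite hh -(cst_int (K%:E * A I z)).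
  apply: (@ge0_le_integral _ (quat R) R sphere_measure) => //.
  by move=> J SJ; exact: hK.
have le2 z : A I z <= K%:E * (h z + h z).
  rewrite hh -(cst_int (A I z)) -ge0_integralZl_EFin//.
  apply: (@ge0_le_integral _ (quat R) R sphere_measure) => //.
  - by move=> J _; exact: A0.
  - exact: measurable_funeM.
  - by move=> J SJ; exact: hK.
have hhE : \int[lebesgue2]_(z in upper_half_plane) h z +
    \int[lebesgue2]_(z in upper_half_plane) h z =
    \int[lebesgue2]_(z in upper_half_plane) (h z + h z).
  apply/esym/(@ge0_integralD _ _ R lebesgue2) => //; exact: measurable_funTS.
have mhh : measurable_fun upper_half_plane (fun z : mR * mR => h z + h z).
  by apply: emeasurable_funD; exact: measurable_funTS.
have mAU : measurable_fun upper_half_plane (A I : mR * mR -> _).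
  by apply: measurable_funTS; exact: mA.
have hh0 z : 0 <= h z + h z by exact: adde_ge0.
rewrite hhE; split.
  rewrite -(@ge0_integralZl_EFin _ _ R lebesgue2 _ mU (A I))//.
  apply: (@ge0_le_integral _ _ R lebesgue2) => //.
  exact: measurable_funeM.
rewrite -(@ge0_integralZl_EFin _ _ R lebesgue2 _ mU (fun z => h z + h z))//.
apply: (@ge0_le_integral _ _ R lebesgue2) => //.
- by move=> z _; exact: A0.
- exact: measurable_funeM.
- by move=> z _; exact: le2.
Qed.

End Comparison.

(** * Equivalence and isometry of the Fock norms *)

Section FockNorms.
Context {R : realType}.
Implicit Types (p alpha K : R) (I J : quat R) (f : quat R -> quat R).

Lemma slice_value_sqr f : slice_regular f ->
  exists v : R * R -> R, forall J z, imag_sphere J ->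
    qabs (f (slice_point J z)) ^+ 2 + qabs (f (slice_point (- J) z)) ^+ 2 = v z.
Proof.
move=> [f0 [f1 [[_ _ fE] _ _ _]]].
exists (fun z => 2 * (qabs (f0 z) ^+ 2 + qabs (f1 z) ^+ 2)) => J z hJ.
by rewrite !fE//; [exact: qabs_parallelogram|exact: imag_sphereN].
Qed.

(* The weight depends only on the modulus, hence the sum of squares over
   antipodal points is unchanged when the direction varies. *)
Lemma weighted_value_sqr alpha f J J' (z : R * R) : slice_regular f ->
  imag_sphere J -> imag_sphere J' ->
  let w q := qabs (f q) * expR (- alpha * qabs q ^+ 2 / 2) in
  w (slice_point J z) ^+ 2 + w (slice_point (- J) z) ^+ 2 =
  w (slice_point J' z) ^+ 2 + w (slice_point (- J') z) ^+ 2.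
Proof.
move=> /slice_value_sqr[v vE] hJ hJ' w.
have hN := imag_sphereN hJ; have hN' := imag_sphereN hJ'.
by rewrite /w !exprMn !qabs_slice_point// -!mulrDl !vE.
Qed.

Local Open Scope ereal_scope.

Let lee_EFinDM (a b K c d : R) : (a + b <= K * (c + d))%R ->
  a%:E + b%:E <= K%:E * (c%:E + d%:E).
Proof. by rewrite -!EFinD -EFinM lee_fin. Qed.

Lemma fock_integrand_compare p alpha f : (0 < p)%R -> slice_regular f ->
  forall J J' z, imag_sphere J -> imag_sphere J' ->
  fock_integrand p alpha f (slice_point J z) +
    fock_integrand p alpha f (slice_point (- J)%R z) <=
  (2 `^ (p + 1))%R%:E * (fock_integrand p alpha f (slice_point J' z) +
    fock_integrand p alpha f (slice_point (- J')%R z)).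
Proof.
move=> p0 fr J J' z hJ hJ'; apply: lee_EFinDM.
by apply: powR_sum_bound; rewrite ?mulr_ge0 ?qabs_ge0 ?expR_ge0//;
  exact: weighted_value_sqr.
Qed.

(** For exponent 2 the integrands are the squares themselves, so the two sides are equal. The form
    with constant 1 suits the general comparison. *)
Lemma fock_integrand2_compare alpha f : slice_regular f ->
  forall J J' z, imag_sphere J -> imag_sphere J' ->
  fock_integrand 2 alpha f (slice_point J z) +
    fock_integrand 2 alpha f (slice_point (- J)%R z) <=
  1%:E * (fock_integrand 2 alpha f (slice_point J' z) +
    fock_integrand 2 alpha f (slice_point (- J')%R z)).
Proof.
move=> fr J J' z hJ hJ'; apply: lee_EFinDM.
by rewrite mul1r !powR_mulrn ?mulr_ge0 ?qabs_ge0 ?expR_ge0// (weighted_value_sqr _ _ fr hJ hJ').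
Qed.

Lemma poweR_le p K (x y : \bar R) : (0 <= p)%R -> (0 <= K)%R ->
  0 <= x -> 0 <= y -> x <= K%:E * y -> x `^ p <= (K `^ p)%R%:E * y `^ p.
Proof.
move=> p0 K0 x0 y0 xy; rewrite -poweR_EFin -poweRM ?lee_fin//.
apply: gt0_ler_poweR => //; rewrite in_itv/= leey andbT//.
by rewrite mule_ge0// lee_fin.
Qed.

Lemma compare_fock_norms p alpha K I f : (0 < alpha)%R -> (0 < p)%R ->
  (0 <= K)%R -> imag_sphere I -> slice_regular f ->
  (forall J J' z, imag_sphere J -> imag_sphere J' ->
    fock_integrand p alpha f (slice_point J z) +
      fock_integrand p alpha f (slice_point (- J)%R z) <=
    K%:E * (fock_integrand p alpha f (slice_point J' z) +
      fock_integrand p alpha f (slice_point (- J')%R z))) ->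
  global_norm p alpha f <= (K `^ p^-1)%R%:E * slice_norm p alpha I f /\
  slice_norm p alpha I f <= (K `^ p^-1)%R%:E * global_norm p alpha f.
Proof.
move=> a0 p0 K0 hI fr hK.
have F0 q : 0 <= fock_integrand p alpha f q by rewrite lee_fin powR_ge0.
have mF := measurable_fock_integrand p alpha (slice_regular_measurable fr).
have [] := compare_slice_global mF F0 K0 hI hK.
rewrite /global_norm /slice_norm.
set S := \int[plane_measure I]_(z in _) _; set G := \int[quat_measure]_(z in _) _.
move=> GS SG.
have S0 : 0 <= S.
  by rewrite /S slice_integralE//; apply: integral_ge0 => z _; rewrite adde_ge0.
have G0 : 0 <= G.
  rewrite /G global_integralE//; apply: integral_ge0 => z _.
  by apply: integral_ge0 => J _; exact: F0.
clearbody S G.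
have pi0 := @pi_gt0 R.
set c := (p * alpha / (2 * pi))%R.
have c0 : (0 <= c)%R by rewrite divr_ge0// ?mulr_ge0// ltW.
(* The global normalization is twice the slice constant [c], which absorbs the doubling of [G]. *)
have cE : (p * alpha / pi)%:E * G = c%:E * (G + G).
  transitivity ((c + c)%:E * G); last first.
    by rewrite EFinD ge0_muleDl ?lee_fin// ge0_muleDr//.
  congr (_%:E * _); rewrite /c; move: (@pi R) pi0 => t t0; field; exact: lt0r_neq0.
have pV0 : (0 <= p^-1)%R by rewrite invr_ge0 ltW.
rewrite cE; split; apply: poweR_le => //.
- by rewrite mule_ge0 ?adde_ge0.
- by rewrite mule_ge0.
- by rewrite muleCA lee_wpmul2l// lee_fin.
- by rewrite mule_ge0.
- by rewrite mule_ge0 ?adde_ge0.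
- by rewrite muleCA lee_wpmul2l// lee_fin.
Qed.

End FockNorms.

Lemma fock_equivalent_norms {R : realType} (alpha p : R) (I : quat R) :
  0 < alpha -> 0 < p -> imag_sphere I ->
  global_fock p alpha = slice_fock p alpha I /\
  equivalent_norms (global_fock p alpha)
    (slice_norm p alpha I) (global_norm p alpha).
Proof.
move=> a0 p0 hI; set C := (2 `^ (p + 1)) `^ p^-1.
have C0 : 0 < C by rewrite !powR_gt0.
have cmp f : slice_regular f ->
    (global_norm p alpha f <= C%:E * slice_norm p alpha I f /\
     slice_norm p alpha I f <= C%:E * global_norm p alpha f)%E.
  move=> fr; apply: (@compare_fock_norms _ _ _ (2 `^ (p + 1))) => //.
  exact: fock_integrand_compare.
split.
  apply/seteqP; split=> f [fr fin]; split=> //; have [le1 le2] := cmp f fr.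
    by apply: le_lt_trans le2 _; rewrite lte_mul_pinfty// lee_fin ltW.
  by apply: le_lt_trans le1 _; rewrite lte_mul_pinfty// lee_fin ltW.
(* The lower constant is the second bound of [cmp] solved for the global norm. *)
exists C^-1, C; rewrite invr_gt0; split=> // f [fr _].
by have [le1 le2] := cmp f fr; rewrite lee_pdivrMl.
Qed.

Theorem corollary2p18 (R : realType) (alpha p : R) (I : quat R)
    (halpha : 0 < alpha) (hp : 0 < p) (hI : imag_sphere I) :
  (global_fock p alpha = slice_fock p alpha I /\
   equivalent_norms (global_fock p alpha)
     (slice_norm p alpha I) (global_norm p alpha)) /\
  isometrically_isomorphic (global_fock 2 alpha) (slice_fock 2 alpha I)
    (global_norm 2 alpha) (slice_norm 2 alpha I).
Proof.
split; first exact: fock_equivalent_norms.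
have [<- _] := fock_equivalent_norms halpha (ltr0n R 2) hI.
(* Both spaces are now the same set, and the identity is isometric because [K = 1] yields
   inequalities both ways. *)
exists id; split=> // [|f [fr _]]; first by split=> [f|f g|f Ff]//; exists f.
have [] := compare_fock_norms halpha (ltr0n R 2) ler01 hI fr
  (fock_integrand2_compare alpha fr).
by rewrite powR1 !mul1e => le1 le2; apply/eqP; rewrite eq_le le1 le2.
Qed.
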